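(* Let $N\ge4$, $d\ge1$, $\kappa\ge0$, and let $x_1(t),\dots,x_N(t)\in\mathbb S^d$ be a solution of the Lohe sphere model $$\dot x_i=\frac{\kappa}{N}\sum_{j=1}^N\big(x_j-\langle x_i,x_j\rangle x_i\big),\qquad x_i(0)=x_i^0\in\mathbb S^d,\qquad i=1,\dots,N,$$ with $x_i^0\ne x_j^0$ for all $i\ne j$. Then for any distinct indices $a,b,c,d'\in\{1,\dots,N\}$ the cross-ratio $$H_{abcd'}(t):=\frac{\|x_a(t)-x_b(t)\|\cdot\|x_c(t)-x_{d'}(t)\|}{\|x_a(t)-x_c(t)\|\cdot\|x_b(t)-x_{d'}(t)\|}$$ is constant in time: $\frac{d}{dt}H_{abcd'}=0$.
   Context: $\mathbb S^d$ is the unit sphere in $\mathbb R^{d+1}$ with Euclidean inner product $\langle\cdot,\cdot\rangle$ and norm $\|\cdot\|$. *)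

(* Defs.v *)
From HB Require Import structures.
From mathcomp Require Import all_boot all_order all_algebra.
From mathcomp Require Import all_classical all_reals all_analysis.

Set Implicit Arguments.
Unset Strict Implicit.
Unset Printing Implicit Defensive.

Import Order.TTheory GRing.Theory Num.Theory.
Import numFieldNormedType.Exports.

Local Open Scope classical_set_scope.
Local Open Scope ring_scope.

Definition dotp (R : realType) (n : nat) (u v : 'rV[R]_n) : R :=
  \sum_(k < n) u 0 k * v 0 k.

(* The library norm on ['rV[R]_n] is the sup norm, hence a separate Euclidean
   norm; both induce the same topology, so derivatives of curves in
   ['rV[R]_n] are the usual ones. *)
Definition enorm (R : realType) (n : nat) (u : 'rV[R]_n) : R :=
  Num.sqrt (dotp u u).

Definition unit_sphere (R : realType) (d : nat) : set 'rV[R]_d.+1 :=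
  [set u | enorm u = 1].

Definition lohe_field (R : realType) (N d : nat) (kappa : R)
    (y : 'I_N -> 'rV[R]_d.+1) (i : 'I_N) : 'rV[R]_d.+1 :=
  (kappa / N%:R) *: \sum_(j < N) (y j - dotp (y i) (y j) *: y i).

(* Solution on a time interval [J] containing 0 (for instance [`[0, +oo[]).
   The equation is required in the interior of [J], with continuity up to the
   endpoints that belong to [J]; since the vector field is continuous, the
   equation then also holds at these endpoints with one-sided derivatives. *)
Record lohe_solution (R : realType) (N d : nat) (kappa : R) (J : interval R)
    (x0 : 'I_N -> 'rV[R]_d.+1) (x : 'I_N -> R -> 'rV[R]_d.+1) : Prop :=
  LoheSolution {
    lohe_time0 : 0 \in J ;
    lohe_sphere : forall i (t : R), t \in J -> x i t \in @unit_sphere R d ;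
    lohe_cont : forall i, {within [set` J], continuous (x i)} ;
    lohe_ode : forall i (t : R), interior [set` J] t ->
      is_derive t 1 (x i) (lohe_field kappa (fun j => x j t) i) ;
    lohe_init : forall i, x i 0 = x0 i }.

Definition cross_ratio (R : realType) (n : nat) (p q r s : 'rV[R]_n) : R :=
  (enorm (p - q) * enorm (r - s)) / (enorm (p - r) * enorm (q - s)).

(* Main.v *)
(* With [S = \sum_k x_k], the squared distance [D_ij] of two particles satisfies
   the linear equation [D_ij' = - kappa / N * (<x_i, S> + <x_j, S>) * D_ij], whose
   rate is bounded and is a sum of one term per index.  By Gronwall, particles
   that start apart never meet, and [D_ab * D_ce] and [D_ac * D_be], which have
   the same rate, keep a constant ratio; the cross-ratio is its square root. *)
Require Import Defs.
From HB Require Import structures.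
From mathcomp Require Import all_boot all_order all_algebra.
From mathcomp Require Import all_classical all_reals all_analysis.
From mathcomp Require Import ring lra.
Set Implicit Arguments.
Unset Strict Implicit.
Unset Printing Implicit Defensive.
Import Order.TTheory GRing.Theory Num.Theory.
Import numFieldNormedType.Exports.
Local Open Scope classical_set_scope.
Local Open Scope ring_scope.

(** * Algebra of the Euclidean inner product *)

Lemma dotpC (R : realType) (n : nat) (u v : 'rV[R]_n) : dotp u v = dotp v u.
Proof. by apply: eq_bigr => k _; rewrite mulrC. Qed.

Lemma dotpDl (R : realType) (n : nat) (u v w : 'rV[R]_n) :
  dotp (u + v) w = dotp u w + dotp v w.
Proof. by rewrite -big_split; apply: eq_bigr => k _; rewrite mxE mulrDl. Qed.

Lemma dotpZl (R : realType) (n : nat) (r : R) (u w : 'rV[R]_n) :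
  dotp (r *: u) w = r * dotp u w.
Proof. by rewrite mulr_sumr; apply: eq_bigr => k _; rewrite mxE mulrA. Qed.

Lemma dotpNl (R : realType) (n : nat) (u w : 'rV[R]_n) :
  dotp (- u) w = - dotp u w.
Proof. by rewrite -scaleN1r dotpZl mulN1r. Qed.

Lemma dotpDr (R : realType) (n : nat) (u v w : 'rV[R]_n) :
  dotp u (v + w) = dotp u v + dotp u w.
Proof. by rewrite dotpC dotpDl !(dotpC u). Qed.

Lemma dotpZr (R : realType) (n : nat) (r : R) (u w : 'rV[R]_n) :
  dotp u (r *: w) = r * dotp u w.
Proof. by rewrite dotpC dotpZl dotpC. Qed.

Lemma dotpNr (R : realType) (n : nat) (u w : 'rV[R]_n) :
  dotp u (- w) = - dotp u w.
Proof. by rewrite dotpC dotpNl dotpC. Qed.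

Lemma dotp_sumr (R : realType) (n : nat) (I : finType) (u : 'rV[R]_n)
    (v : I -> 'rV[R]_n) :
  dotp u (\sum_i v i) = \sum_i dotp u (v i).
Proof.
rewrite exchange_big /=; apply: eq_bigr => k _.
by rewrite summxE mulr_sumr.
Qed.

Lemma dotp_ge0 (R : realType) (n : nat) (u : 'rV[R]_n) : 0 <= dotp u u.
Proof. by apply: sumr_ge0 => k _; rewrite -expr2 sqr_ge0. Qed.

Lemma dotp_eq0 (R : realType) (n : nat) (u : 'rV[R]_n) :
  (dotp u u == 0) = (u == 0).
Proof.
apply/idP/eqP => [|->]; last first.
  by rewrite /dotp big1 // => k _; rewrite mxE mul0r.
rewrite psumr_eq0 => [/allP u0|k _]; last by rewrite -expr2 sqr_ge0.
apply/rowP => k; rewrite mxE; apply/eqP.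
by have := u0 k (mem_index_enum k); rewrite mulf_eq0 orbb.
Qed.

Lemma dotp_sphere (R : realType) (d : nat) (u : 'rV[R]_d.+1) :
  u \in @unit_sphere R d -> dotp u u = 1.
Proof.
rewrite inE /unit_sphere /= /enorm => /(congr1 (fun r => r ^+ 2)).
by rewrite sqr_sqrtr ?dotp_ge0 // expr1n.
Qed.

(** Cauchy-Schwarz for unit vectors: the squared norms of [u + v] and [u - v] are [2 + 2 * dotp u v]
    and [2 - 2 * dotp u v], both nonnegative. *)
Lemma dotp_sphere_le1 (R : realType) (n : nat) (u v : 'rV[R]_n) :
  dotp u u = 1 -> dotp v v = 1 -> `|dotp u v| <= 1.
Proof.
move=> u1 v1; have := dotp_ge0 (u + v); have := dotp_ge0 (u - v).
rewrite !(dotpDl, dotpDr, dotpNl, dotpNr) u1 v1 (dotpC v u) ler_norml.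
by move=> ? ?; apply/andP; split; lra.
Qed.

(** Being polynomial in the coordinates, it can be differentiated even where the points meet, unlike
    the distance. *)
Definition sqdist (R : realType) (n : nat) (u v : 'rV[R]_n) : R :=
  dotp (u - v) (u - v).

Lemma sqdist_eq0 (R : realType) (n : nat) (u v : 'rV[R]_n) :
  (sqdist u v == 0) = (u == v).
Proof. by rewrite dotp_eq0 subr_eq0. Qed.

(** Valid for degenerate points too, since the inverse of 0 is 0. *)
Lemma cross_ratioE (R : realType) (n : nat) (p q r s : 'rV[R]_n) :
  cross_ratio p q r s =
  Num.sqrt ((sqdist p q * sqdist r s) / (sqdist p r * sqdist q s)).
Proof.
rewrite /cross_ratio /enorm sqrtrM ?mulr_ge0 ?dotp_ge0 //.
by rewrite sqrtrV ?mulr_ge0 ?dotp_ge0 // !sqrtrM ?dotp_ge0.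
Qed.

(** * Differentiation and continuity of inner products of curves *)

Lemma is_derive_dotp (R : realType) (n : nat) (u v : R -> 'rV[R]_n.+1) (t : R)
    (du dv : 'rV[R]_n.+1) :
  is_derive t 1 u du -> is_derive t 1 v dv ->
  is_derive t 1 (fun s => dotp (u s) (v s)) (dotp du (v t) + dotp (u t) dv).
Proof.
have coord (w : R -> 'rV[R]_n.+1) dw k : is_derive t 1 w dw ->
    is_derive t 1 (fun s => w s 0 k) (dw 0 k).
  move=> [dvw <-]; rewrite derive_mx // mxE.
  by apply: DeriveDef => //; exact: (derivable_mxP _ _ _).1.
move=> ud vd.
have -> : (fun s => dotp (u s) (v s)) =
    \sum_(k < n.+1) ((fun s => u s 0 k) * (fun s => v s 0 k)).
  by apply/funext => s; rewrite fct_sumE.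
rewrite -big_split /=; apply: is_derive_sum => k.
have ukd := coord _ _ k ud; have vkd := coord _ _ k vd.
apply: is_derive_eq.
by rewrite [RHS]addrC [in RHS](mulrC (du 0 k)).
Qed.

Lemma continuous_dotp (R : realType) (n : nat) (T : topologicalType)
    (u v : T -> 'rV[R]_n.+1) :
  continuous u -> continuous v -> continuous (fun s => dotp (u s) (v s)).
Proof.
move=> uc vc.
have coord (w : T -> 'rV[R]_n.+1) k : continuous w ->
    continuous (fun s => w s 0 k).
  move=> wc s.
  exact: (cvg_comp w (fun M : 'rV[R]_n.+1 => M 0 k) (wc s)
    (@coord_continuous R 1 n.+1 0 k (w s))).
have uvc (k : 'I_n.+1) : true -> continuous (fun s => u s 0 k * v s 0 k).
  by move=> _ s; apply: cvgM; exact: coord.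
exact: (@continuous_big R _ +%R 0 xpredT (@add_continuous R) T _ _ uvc).
Qed.

(** * Propagation of zeros for scalar linear differential equations *)

Lemma itv_cc_sub (R : realType) (J : interval R) (s t : R) :
  s \in J -> t \in J -> `[s, t] `<=` [set` J].
Proof.
by move=> sJ tJ u /=; rewrite in_itv /=; exact: interval_is_interval.
Qed.

Lemma itv_oo_sub_interior (R : realType) (J : interval R) (s t : R) :
  s \in J -> t \in J -> `]s, t[ `<=` interior [set` J].
Proof.
move=> sJ tJ; rewrite -(interior_itv_bnd s t true false).
exact/interiorS/itv_cc_sub.
Qed.

(* Gronwall: [f ^+ 2] times [expR (2 * K * u)] is nondecreasing and
   [f ^+ 2] times [expR (- 2 * K * u)] is nonincreasing. *)
Lemma linear_ode_eq0 (R : realType) (J : interval R) (f g : R -> R) (K s t : R) :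
  {within [set` J], continuous f} ->
  (forall u, interior [set` J] u -> is_derive u 1 f (g u * f u)) ->
  (forall u, interior [set` J] u -> `|g u| <= K) ->
  s \in J -> t \in J -> f s = 0 -> f t = 0.
Proof.
move=> fc fd gK sJ tJ fs0.
pose h (m u : R) := f u ^+ 2 * expR (m * u).
(* The sign of [g u + m / 2] decides the monotonicity of [h m]; it is constant for [m = 2 * K] and
   for [m = - (2 * K)]. *)
have hd m u : interior [set` J] u ->
    is_derive u 1 (h m) (2 * (g u + m / 2) * h m u).
  move=> Ju; have fdu := fd _ Ju.
  have ed : is_derive u 1 (fun v => expR (m * v)) (m * expR (m * u)).
    have mud := is_deriveZ m (is_derive_id u (1 : R)).
    have ed := is_derive1_comp (is_derive_expR (m * u)) mud.
    by apply: is_derive_eq; rewrite mulrC [_ *: _]mulr1.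
  have f2d := is_deriveX 2 fdu.
  have hd := is_deriveM f2d ed; apply: is_derive_eq.
  by rewrite /h /GRing.scale /= !fctE expr1; field.
have hc m (a b : R) : a \in J -> b \in J -> {within `[a, b], continuous (h m)}.
  move=> aJ bJ; apply: continuous_subspaceW (itv_cc_sub aJ bJ) _ => u.
  apply: cvgM; first by apply: cvgM; exact: fc.
  apply: continuous_subspaceT => v.
  by apply: continuous_comp; [exact: mulrl_continuous|exact: continuous_expR].
have h0 m u : h m u <= 0 -> f u = 0.
  rewrite /h pmulr_lle0 ?expR_gt0// => f0; apply/eqP.
  by rewrite -sqrf_eq0 eq_le f0 sqr_ge0.
have hge0 m u : 0 <= h m u by rewrite mulr_ge0 ?sqr_ge0 ?expR_ge0.
have hs m : h m s = 0 by rewrite /h fs0 expr0n mul0r.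
(* Zeros propagate forward with [m = - (2 * K)] and backward with [m = 2 * K]: by the mean value
   theorem, [h m t <= h m s = 0] in both cases. *)
have [st|ts|<-//] := ltgtP s t.
- have hd' u : u \in `]s, t[ -> is_derive u 1 (h (- (2 * K)))
     (2 * (g u + - (2 * K) / 2) * h (- (2 * K)) u).
    by move=> stu; apply: hd; exact: itv_oo_sub_interior stu.
  have [c cst] := MVT st hd' (hc _ _ _ sJ tJ).
  rewrite hs subr0 => htE; apply: (h0 (- (2 * K))); rewrite htE.
  apply: mulr_le0_ge0; last by rewrite subr_ge0 ltW.
  apply: mulr_le0_ge0 => //.
  have := gK _ (itv_oo_sub_interior sJ tJ cst).
  by rewrite ler_norml => /andP[_ ?]; lra.
- have hd' u : u \in `]t, s[ -> is_derive u 1 (h (2 * K))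
     (2 * (g u + (2 * K) / 2) * h (2 * K) u).
    by move=> stu; apply: hd; exact: itv_oo_sub_interior stu.
  have [c cst] := MVT ts hd' (hc _ _ _ tJ sJ).
  rewrite hs sub0r => htE; apply: (h0 (2 * K)); rewrite -oppr_ge0 htE.
  apply: mulr_ge0; last by rewrite subr_ge0 ltW.
  apply: mulr_ge0 => //.
  have := gK _ (itv_oo_sub_interior tJ sJ cst).
  by rewrite ler_norml => /andP[? _]; lra.
Qed.

(** * Growth rate of squared distances under the Lohe field *)

Lemma is_derive_sqdist (R : realType) (n : nat) (u v : R -> 'rV[R]_n.+1) (t : R)
    (du dv : 'rV[R]_n.+1) :
  is_derive t 1 u du -> is_derive t 1 v dv ->
  is_derive t 1 (fun s => sqdist (u s) (v s)) (2 * dotp (du - dv) (u t - v t)).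
Proof.
move=> ud vd; have wd := is_deriveB ud vd.
have w2d := is_derive_dotp wd wd; apply: is_derive_eq.
by rewrite [X in _ + X]dotpC !fctE mulr2n mulrDl mul1r.
Qed.

(** The field at [y i] is [kappa / N] times [S - <y i, S> y i], so [S] cancels in the difference.
    What remains factors through [1 - <y i, y j>], which for unit vectors is half the squared
    distance. *)
Lemma sqdist_lohe_field (R : realType) (N d : nat) (kappa : R)
    (y : 'I_N -> 'rV[R]_d.+1) (i j : 'I_N) :
  let S := \sum_k y k in
  dotp (y i) (y i) = 1 -> dotp (y j) (y j) = 1 ->
  2 * dotp (lohe_field kappa y i - lohe_field kappa y j) (y i - y j) =
  - (kappa / N%:R * (dotp (y i) S + dotp (y j) S)) * sqdist (y i) (y j).
Proof.
move=> S yi1 yj1.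
have fieldE k : lohe_field kappa y k =
    (kappa / N%:R) *: (S - dotp (y k) S *: y k).
  by rewrite /lohe_field sumrB -scaler_suml -dotp_sumr.
rewrite !fieldE /sqdist !(dotpDl, dotpDr, dotpNl, dotpNr, dotpZl, dotpZr).
rewrite yi1 yj1 (dotpC (y j) (y i)) !(dotpC _ S); ring.
Qed.

Lemma norm_dotp_sum_le (R : realType) (N d : nat) (y : 'I_N -> 'rV[R]_d)
    (i : 'I_N) :
  (forall k, dotp (y k) (y k) = 1) -> `|dotp (y i) (\sum_k y k)| <= N%:R.
Proof.
move=> y1; rewrite dotp_sumr; apply: le_trans (ler_norm_sum _ _ _) _.
rewrite -[X in _ <= X%:R]card_ord -sum1_card natr_sum.
by apply: ler_sum => k _; exact: dotp_sphere_le1.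
Qed.

(** The logarithmic derivative of the squared distance of two particles, with one summand per
    index. *)
Definition sqdist_rate (R : realType) (N d : nat) (kappa : R)
    (y : 'I_N -> 'rV[R]_d) (i j : 'I_N) : R :=
  - (kappa / N%:R * (dotp (y i) (\sum_k y k) + dotp (y j) (\sum_k y k))).

(** Each of the two inner products is at most [N] in absolute value, which cancels the factor
    [1 / N]. *)
Lemma norm_sqdist_rate_le (R : realType) (N d : nat) (kappa : R)
    (y : 'I_N -> 'rV[R]_d) (i j : 'I_N) :
  0 <= kappa -> (forall k, dotp (y k) (y k) = 1) ->
  `|sqdist_rate kappa y i j| <= 2 * kappa.
Proof.
move=> kappa0 y1.
have N0 : 0 < N%:R :> R by rewrite ltr0n (leq_trans _ (ltn_ord i)).
rewrite normrN normrM ger0_norm ?divr_ge0 ?ler0n//.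
rewrite mulrAC ler_pdivrMr// -mulrA mulrCA ler_wpM2l//.
apply: le_trans (ler_normD _ _) _; rewrite mulrDl mul1r.
by apply: lerD; exact: norm_dotp_sum_le.
Qed.

(** * Squared distances along a solution *)

Section LoheSqdist.
Context (R : realType) (N d : nat) (kappa : R) (J : interval R)
  (x0 : 'I_N -> 'rV[R]_d.+1) (x : 'I_N -> R -> 'rV[R]_d.+1) (hx : lohe_solution kappa J x0 x).

Lemma lohe_dotp1 (i : 'I_N) (t : R) : t \in J -> dotp (x i t) (x i t) = 1.
Proof. by move=> /(lohe_sphere hx i)/dotp_sphere. Qed.

Lemma lohe_sqdist_continuous (i j : 'I_N) :
  {within [set` J], continuous (fun t => sqdist (x i t) (x j t))}.
Proof.
have xc : {within [set` J], continuous (x i - x j)}.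
  by move=> t; apply: cvgB; exact: (lohe_cont hx).
exact: (continuous_dotp xc xc).
Qed.

Lemma is_derive_lohe_sqdist (i j : 'I_N) (t : R) :
  interior [set` J] t ->
  is_derive t 1 (fun s => sqdist (x i s) (x j s))
    (sqdist_rate kappa (fun k => x k t) i j * sqdist (x i t) (x j t)).
Proof.
move=> Jt; have tJ := interior_subset Jt.
rewrite -sqdist_lohe_field; [|exact: lohe_dotp1..].
by apply: is_derive_sqdist; exact: (lohe_ode hx).
Qed.

(** Gronwall is applied from time [t] to time 0: a zero of the squared distance at [t] forces one at
    0. *)
Lemma lohe_collision (i j : 'I_N) (t : R) :
  0 <= kappa -> t \in J -> x i t = x j t -> x0 i = x0 j.
Proof.
move=> kappa0 tJ xij; rewrite -!(lohe_init hx); apply/eqP; rewrite -sqdist_eq0.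
apply/eqP; apply: (@linear_ode_eq0 R J (fun s => sqdist (x i s) (x j s))
  (fun s => sqdist_rate kappa (fun k => x k s) i j) (2 * kappa) t) => //.
- exact: lohe_sqdist_continuous.
- exact: is_derive_lohe_sqdist.
- move=> u /interior_subset uJ; apply: norm_sqdist_rate_le => // k.
  exact: lohe_dotp1.
- exact: lohe_time0 hx.
by apply/eqP; rewrite sqdist_eq0 xij.
Qed.

(* Both sides solve, as functions of [t], the same linear equation: the rates
   of [sqdist] are additive in the two indices, so the products pairing
   [{a, b, c, e}] have a common rate. *)
Lemma lohe_sqdist_cross (a b c e : 'I_N) (t : R) :
  let D i j s := sqdist (x i s) (x j s) in
  0 <= kappa -> t \in J ->
  D a b t * D c e t * (D a c 0 * D b e 0) =
  D a c t * D b e t * (D a b 0 * D c e 0).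
Proof.
move=> D kappa0 tJ; apply/eqP; rewrite -subr_eq0; apply/eqP.
(* These weights make the difference of the two sides vanish at time 0. *)
pose m := D a c 0 * D b e 0; pose n := D a b 0 * D c e 0.
pose rate i j s := sqdist_rate kappa (fun k => x k s) i j.
have Dc i j : {within [set` J], continuous (D i j)}.
  exact: lohe_sqdist_continuous.
have Fc : {within [set` J], continuous
    (fun s => D a b s * D c e s * m - D a c s * D b e s * n)}.
  move=> s; apply: cvgB; (apply: cvgM; last exact: cvg_cst);
    by apply: cvgM; exact: Dc.
have Fd s : interior [set` J] s ->
    is_derive s 1 (fun s => D a b s * D c e s * m - D a c s * D b e s * n)
      ((rate a b s + rate c e s) *
        (D a b s * D c e s * m - D a c s * D b e s * n)).
  move=> Js.
  have Dd i j := is_derive_lohe_sqdist i j Js.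
  have abced := is_deriveM (is_deriveM (Dd a b) (Dd c e)) (is_derive_cst m s 1).
  have acbed := is_deriveM (is_deriveM (Dd a c) (Dd b e)) (is_derive_cst n s 1).
  have Fd := is_deriveB abced acbed.
  apply: is_derive_eq.
  (* Unfolding the rates shows that the pairs [ab], [ce] and the pairs [ac], [be] have the same
     total, each index occurring once. *)
  by rewrite /GRing.scale /= !fctE /D /rate /sqdist_rate; ring.
(* The common rate is a sum of two rates, each bounded by [2 * kappa]. *)
apply: (linear_ode_eq0 (K := 4 * kappa) Fc Fd _ (lohe_time0 hx) tJ).
  move=> s /interior_subset sJ; apply: le_trans (ler_normD _ _) _.
  have rateb i j : `|rate i j s| <= 2 * kappa.
    by apply: norm_sqdist_rate_le => // k; exact: lohe_dotp1.
  by have := rateb a b; have := rateb c e; lra.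
by rewrite /m /n; ring.
Qed.

End LoheSqdist.

Theorem theorem4p1 (R : realType) (N d : nat) (hN : (4 <= N)%N) (hd : (1 <= d)%N)
    (kappa : R) (hkappa : 0 <= kappa) (J : interval R)
    (x0 : 'I_N -> 'rV[R]_d.+1) (hx0 : forall i, x0 i \in @unit_sphere R d)
    (hx0_neq : forall i j, i != j -> x0 i != x0 j)
    (x : 'I_N -> R -> 'rV[R]_d.+1) (hx : lohe_solution kappa J x0 x)
    (a b c e : 'I_N) (habce : uniq [:: a; b; c; e]) :
  let H := fun t : R => cross_ratio (x a t) (x b t) (x c t) (x e t) in
  [/\ forall t : R, t \in J -> x a t != x c t /\ x b t != x e t,
      forall t : R, interior [set` J] t -> is_derive t 1 H 0
    & forall t : R, t \in J -> H t = H 0].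
Proof.
move=> H.
have neq i j t : i != j -> t \in J -> x i t != x j t.
  move=> ij tJ; apply: contraNN (hx0_neq _ _ ij) => /eqP xij.
  exact/eqP/(lohe_collision hx hkappa tJ xij).
have /and3P[] := habce; rewrite !inE !negb_or => /and3P[ab ac ae] /andP[bc be].
rewrite andbT => ce.
(* Constancy on all of [J] comes first. Absence of collisions keeps the denominators nonzero, so the
   fractions may be compared by cross-multiplication. *)
have H0 t : t \in J -> H t = H 0.
  move=> tJ; rewrite /H !cross_ratioE; congr Num.sqrt.
  have D0 i j s : i != j -> s \in J -> sqdist (x i s) (x j s) != 0.
    by move=> ij sJ; rewrite sqdist_eq0 neq.
  apply/eqP; rewrite eqr_div ?mulf_neq0 ?D0 ?(lohe_time0 hx)//.
  by rewrite (lohe_sqdist_cross hx) // mulrC.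
split => // [t tJ|t Jt]; first by split; exact: neq.
(* Near an interior time [H] coincides with a constant, so no square root has to be
   differentiated. *)
apply: (near_eq_is_derive _ (is_derive_cst (H 0) t 1)).
by apply: filterS (Jt) => s /H0 ->.
Qed.
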